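(* The pair $(\mathrm{Bmod}^{\mathfrak s},\mathcal N)$, consisting of the category $\mathrm{Bmod}^{\mathfrak s}$ of $\mathbb B$-modules with involution and the class $\mathcal N$ of null morphisms, forms a homological category in the sense of Grandis.
   Context: $\mathbb B=\{0,1\}$ is the Boolean semifield ($1+1=1$). A $\mathbb B$-module is a commutative monoid $(M,+,0)$ with $x+x=x$ for all $x$; morphisms are the monoid homomorphisms. $\mathrm{Bmod}^{\mathfrak s}$ is the category whose objects are $\mathbb B$-modules $M$ endowed with an involution $\sigma$ (an endomorphism of the $\mathbb B$-module $M$ with $\sigma^2=\mathrm{id}$), and whose morphisms are the $\mathbb B$-module morphisms commuting with $\sigma$. A morphism $f:L\to M$ of $\mathrm{Bmod}^{\mathfrak s}$ is null if $f(x)=\sigma(f(x))$ for all $x\in L$; $\mathcal N$ denotes the class of null morphisms. Homological categories (Grandis). Let $\mathcal E$ be a category with a class $\mathcal N$ of morphisms. $\mathcal N$ is an ideal if $g f h\in\mathcal N$ whenever $f\in\mathcal N$ and the composite is defined; it is closed if every $f\in\mathcal N$ factors through an object whose identity is in $\mathcal N$ (a null object). A kernel of $f:L\to M$ (with respect to $\mathcal N$) is a morphism $\ker f:\mathrm{Ker}(f)\to L$ such that $f\circ\ker f\in\mathcal N$ and every $g$ with $f\circ g\in\mathcal N$ factors uniquely as $g=\ker f\circ h$; cokernels $\mathrm{cok} f:M\to\mathrm{Coker}(f)$ are defined dually. $(\mathcal E,\mathcal N)$ is semiexact if $\mathcal N$ is a closed ideal and every morphism has a kernel and a cokernel with respect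 to $\mathcal N$. In a semiexact category, a normal monomorphism is a morphism which is a kernel of some morphism, a normal epimorphism is one which is a cokernel of some morphism. Every $f:L\to M$ factors uniquely as $L\to \mathrm{Coker}(\ker f)\xrightarrow{\tilde f}\mathrm{Ker}(\mathrm{cok} f)\to M$, where the first arrow is $\mathrm{cok}(\ker f)$ and the last is $\ker(\mathrm{cok} f)$; $f$ is exact if $\tilde f$ is an isomorphism. A semiexact category is homological if: (ex2) normal monomorphisms and normal epimorphisms are stable under composition; (ex3) for every normal monomorphism $m:M\to N$ and normal epimorphism $q:N\to Q$ with $m\ge \ker q$ as subobjects of $N$ (i.e. $\ker q$ factors through $m$), the morphism $q\circ m$ is exact. *)

(* Defs.v *)
From HB Require Import structures.
From mathcomp Require Import all_boot all_algebra.
From mathcomp Require Import boolp.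

Set Implicit Arguments.
Unset Strict Implicit.
Unset Printing Implicit Defensive.

Import GRing.Theory.
Local Open Scope ring_scope.

Declare Scope cat_scope.
Delimit Scope cat_scope with cat.

Record category := Category {
  obj :> Type;
  hom : obj -> obj -> Type;
  idc : forall A, hom A A;
  compc : forall A B D, hom B D -> hom A B -> hom A D;
  compc1 : forall A B (f : hom A B), compc f (idc A) = f;
  comp1c : forall A B (f : hom A B), compc (idc B) f = f;
  compcA : forall A B D E (h : hom D E) (g : hom B D) (f : hom A B),
    compc h (compc g f) = compc (compc h g) f
}.

Arguments hom {c} A B.
Arguments idc {c} A.
Arguments compc {c A B D} g f.
Notation "g \oc f" := (compc g f)
  (at level 50, left associativity, format "g  \oc  f") : cat_scope.
Local Open Scope cat_scope.

Definition isoc (C : category) (A B : C) (f : hom A B) : Prop :=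
  exists g : hom B A, g \oc f = idc A /\ f \oc g = idc B.

Definition hom_class (C : category) := forall A B : C, hom A B -> Prop.

Section Grandis.
Variables (C : category) (N : hom_class C).

Definition hom_ideal : Prop :=
  forall (A B D E : C) (h : hom A B) (f : hom B D) (g : hom D E),
    N f -> N (g \oc f \oc h).

Definition null_object (Z : C) : Prop := N (idc Z).

Definition closed_ideal : Prop :=
  hom_ideal /\
  forall (A B : C) (f : hom A B), N f ->
    exists (Z : C) (g : hom A Z) (h : hom Z B), null_object Z /\ f = h \oc g.

Definition is_kernel (L M : C) (f : hom L M) (K : C) (k : hom K L) : Prop :=
  N (f \oc k) /\
  forall (X : C) (g : hom X L), N (f \oc g) ->
    exists! h : hom X K, g = k \oc h.

Definition is_cokernel (L M : C) (f : hom L M) (Q : C) (c : hom M Q) : Prop :=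
  N (c \oc f) /\
  forall (X : C) (g : hom M X), N (g \oc f) ->
    exists! h : hom Q X, g = h \oc c.

Definition semiexact : Prop :=
  [/\ closed_ideal,
      forall (L M : C) (f : hom L M), exists (K : C) (k : hom K L), is_kernel f k
    & forall (L M : C) (f : hom L M), exists (Q : C) (c : hom M Q), is_cokernel f c].

Definition normal_mono (M P : C) (m : hom M P) : Prop :=
  exists (R : C) (f : hom P R), is_kernel f m.

Definition normal_epi (P Q : C) (q : hom P Q) : Prop :=
  exists (R : C) (f : hom R P), is_cokernel f q.

(* k = ker f, c = cok k, p = cok f, i = ker p, and t is the induced morphism
   Coker (ker f) -> Ker (cok f). *)
Definition normal_factorization (L M : C) (f : hom L M)
    (K : C) (k : hom K L) (Q : C) (c : hom L Q)
    (P : C) (p : hom M P) (I : C) (i : hom I M) (t : hom Q I) : Prop :=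
  [/\ is_kernel f k, is_cokernel k c, is_cokernel f p, is_kernel p i
    & f = i \oc t \oc c].

(* Kernels and cokernels are unique up to a unique isomorphism, so the choice
   of k, c, p and i is immaterial; t is determined by normal_factorization_ex
   below. *)
Definition exact_hom (L M : C) (f : hom L M) : Prop :=
  exists (K : C) (k : hom K L) (Q : C) (c : hom L Q)
         (P : C) (p : hom M P) (I : C) (i : hom I M) (t : hom Q I),
    normal_factorization f k c p i t /\ isoc t.

Definition ex2 : Prop :=
  (forall (A B D : C) (m : hom A B) (n : hom B D),
     normal_mono m -> normal_mono n -> normal_mono (n \oc m)) /\
  (forall (A B D : C) (p : hom A B) (q : hom B D),
     normal_epi p -> normal_epi q -> normal_epi (q \oc p)).

Definition ex3 : Prop :=
  forall (M P Q : C) (m : hom M P) (q : hom P Q) (K : C) (k : hom K P),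
    normal_mono m -> normal_epi q -> is_kernel q k ->
    (exists h : hom K M, k = m \oc h) ->
    exact_hom (q \oc m).

Definition homological : Prop := [/\ semiexact, ex2 & ex3].

Lemma kernel_inj (L M : C) (f : hom L M) (K : C) (k : hom K L) :
  hom_ideal -> is_kernel f k ->
  forall (X : C) (x y : hom X K), k \oc x = k \oc y -> x = y.
Proof.
move=> idN [fk kU] X x y kxy.
have [|h [_ hU]] := kU X (k \oc x).
  by rewrite compcA -(comp1c (f \oc k)); apply: idN.
by rewrite -(hU x erefl); apply: hU.
Qed.

Lemma cokernel_inj (L M : C) (f : hom L M) (Q : C) (c : hom M Q) :
  hom_ideal -> is_cokernel f c ->
  forall (X : C) (x y : hom Q X), x \oc c = y \oc c -> x = y.
Proof.
move=> idN [cf cU] X x y xyc.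
have [|h [_ hU]] := cU X (x \oc c).
  by rewrite -compcA -(compc1 (x \oc (c \oc f))); apply: idN.
by rewrite -(hU x erefl); apply: hU.
Qed.

Lemma normal_factorization_ex (L M : C) (f : hom L M)
    (K : C) (k : hom K L) (Q : C) (c : hom L Q)
    (P : C) (p : hom M P) (I : C) (i : hom I M) :
  closed_ideal ->
  is_kernel f k -> is_cokernel k c -> is_cokernel f p -> is_kernel p i ->
  exists! t : hom Q I, normal_factorization f k c p i t.
Proof.
move=> [idN clN] kf ck pf ip.
have [g [fE _]] := proj2 ck _ f (proj1 kf).
have [Z [a [b [nZ pfE]]]] := clN _ _ _ (proj1 pf).
have nak : N (a \oc k).
  by rewrite -(comp1c (a \oc k)) -(compc1 (idc Z)); apply: idN.
have [a' [aE _]] := proj2 ck _ a nak.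
have pgE : p \oc g = b \oc a'.
  by apply: (cokernel_inj idN ck); rewrite -!compcA -fE -aE.
have [|t [gE _]] := proj2 ip _ g.
  by rewrite pgE -(compc1 b); apply: idN.
exists t; split; first by split=> //; rewrite -gE.
move=> u [_ _ _ _ fE'].
apply: (kernel_inj idN ip); apply: (cokernel_inj idN ck).
by rewrite -fE' -gE.
Qed.

End Grandis.

(* The choiceType structure included in nmodType is no restriction: classically
   every type has one, and morphisms ignore it. *)
Record bmods := BmodsOf {
  bmods_sort :> nmodType;
  addbb : forall x : bmods_sort, x + x = x;
  sigma : {additive bmods_sort -> bmods_sort};
  sigmaK : involutive sigma
}.

Arguments sigma {b}.

Record bmods_hom (L M : bmods) := BmodsHom {
  bmods_fun :> {additive L -> M};
  bmods_homP : forall x : L, bmods_fun (sigma x) = sigma (bmods_fun x)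
}.

Lemma bmods_hom_eq (L M : bmods) (f g : bmods_hom L M) : f =1 g -> f = g.
Proof.
case: f g => [[f [[fP]]] fs] [[g [[gP]]] gs] /= /funext fg.
rewrite /= in fg fs gs *; subst g.
by rewrite (Prop_irrelevance gP fP) in gs *; rewrite (Prop_irrelevance gs fs).
Qed.

Definition bmods_id (L : bmods) : bmods_hom L L :=
  @BmodsHom L L idfun (fun _ => erefl).

Lemma bmods_comp_subproof (L M P : bmods) (g : bmods_hom M P)
    (f : bmods_hom L M) (x : L) : (g \o f) (sigma x) = sigma ((g \o f) x).
Proof. by rewrite /= !bmods_homP. Qed.

Definition bmods_comp (L M P : bmods) (g : bmods_hom M P)
    (f : bmods_hom L M) : bmods_hom L P :=
  @BmodsHom L P (g \o f) (bmods_comp_subproof g f).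

Lemma bmods_compf1 (L M : bmods) (f : bmods_hom L M) :
  bmods_comp f (bmods_id L) = f.
Proof. exact: bmods_hom_eq. Qed.

Lemma bmods_comp1f (L M : bmods) (f : bmods_hom L M) :
  bmods_comp (bmods_id M) f = f.
Proof. exact: bmods_hom_eq. Qed.

Lemma bmods_compA (L M P Q : bmods) (h : bmods_hom P Q) (g : bmods_hom M P)
    (f : bmods_hom L M) :
  bmods_comp h (bmods_comp g f) = bmods_comp (bmods_comp h g) f.
Proof. exact: bmods_hom_eq. Qed.

Definition Bmods : category :=
  Category bmods_compf1 bmods_comp1f bmods_compA.

Definition bmods_null : hom_class Bmods :=
  fun (L M : bmods) (f : bmods_hom L M) => forall x : L, f x = sigma (f x).

(* Main.v *)
(** The kernel of [f] is the submodule of those [x] with [f x] fixed by [sigma],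
    and the cokernel of [f : L -> M] is the quotient of [M] by the congruence
    generated by [x ~ sigma x] for [x] in the image [E] of [f].  As addition is
    idempotent, this congruence is the joinability relation of the confluent,
    increasing rewriting [c --> c + sigma x] for [x] in [E] with [x <= c].  A
    rewriting path starting in a submodule containing [E] never leaves it, so
    the congruence does not change when it is computed in the submodule: this
    gives both the composition of normal monomorphisms and the injectivity of
    the comparison map in (ex3). *)

From HB Require Import structures.
From mathcomp Require Import all_boot all_algebra.
From mathcomp Require Import boolp.
Require Import Defs.

Set Implicit Arguments.
Unset Strict Implicit.
Unset Printing Implicit Defensive.

Import GRing.Theory.
Local Open Scope ring_scope.
Local Open Scope quotient_scope.
Local Open Scope cat_scope.

(** * Morphisms from functions: factorization through injections and surjections, bijections as
    isomorphisms *)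

Lemma bmods_hom_build (L M : bmods) (f : L -> M) :
    f 0 = 0 -> {morph f : x y / x + y} -> (forall x, f (sigma x) = sigma (f x)) ->
  {g : bmods_hom L M | g =1 f}.
Proof.
move=> f0 fD fs; pose fA := GRing.isNmodMorphism.Build L M f (f0, fD).
pose g : {additive L -> M} := HB.pack f fA.
by exists (@BmodsHom L M g fs).
Qed.

Lemma bmods_comp_apply (L M P : Bmods) (g : hom M P) (f : hom L M) (x : bmods_sort L) :
  bmods_fun (g \oc f) x = bmods_fun g (bmods_fun f x).
Proof. by []. Qed.

Lemma bmods_hom_congr (L M : bmods) (f g : bmods_hom L M) (x : L) :
  f = g -> f x = g x.
Proof. by move=> ->. Qed.

Lemma bmods_factor_inj (X K L : bmods) (k : bmods_hom K L) (g : bmods_hom X L) :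
    injective k -> (forall x, exists y, k y = g x) ->
  exists h : bmods_hom X K, g = bmods_comp k h.
Proof.
move=> k_inj /choice[h hE].
have [||x|h' h'E] := @bmods_hom_build X K h.
- by apply: k_inj; rewrite hE !raddf0.
- by move=> x y; apply: k_inj; rewrite raddfD !hE raddfD.
- by apply: k_inj; rewrite hE !bmods_homP hE.
by exists h'; apply: bmods_hom_eq => x /=; rewrite h'E hE.
Qed.

(** The factor is [g] after a section of [c] obtained by choice; since [g] is constant on the fibres
    of [c], it is additive although the section need not be. *)
Lemma bmods_factor_surj (L Q X : bmods) (c : bmods_hom L Q) (g : bmods_hom L X) :
    (forall y, exists x, c x = y) -> (forall a b, c a = c b -> g a = g b) ->
  exists h : bmods_hom Q X, g = bmods_comp h c.
Proof.
move=> /choice[s sK] cg.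
have [||x|h hE] := @bmods_hom_build Q X (g \o s).
- by rewrite /= -[RHS](raddf0 g); apply: cg; rewrite sK raddf0.
- by move=> x y; rewrite /= -raddfD; apply: cg; rewrite raddfD !sK.
- by rewrite /= -bmods_homP; apply: cg; rewrite bmods_homP !sK.
by exists h; apply: bmods_hom_eq => x /=; rewrite hE /=; apply: cg; rewrite sK.
Qed.

Lemma bmods_bij_iso (L M : bmods) (t : bmods_hom L M) :
  injective t -> (forall y, exists x, t x = y) -> @isoc Bmods L M t.
Proof.
move=> t_inj t_surj.
have [h hE] := bmods_factor_inj (g := bmods_id M) t_inj t_surj.
have tK y : t (h y) = y by rewrite -[RHS]/(bmods_id M y) hE.
exists h; split; apply: bmods_hom_eq => x //=.
by apply: t_inj; rewrite tK.
Qed.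

Lemma bmods_null_ideal : hom_ideal bmods_null.
Proof.
by move=> A B D E h f g f0 x; rewrite !bmods_comp_apply -bmods_homP -f0.
Qed.

(** * The kernel submodule with its restricted involution *)

Section KernelObject.
Variables (L M : bmods) (f : bmods_hom L M).

Definition ker_pred : {pred L} := fun x => `[< f x = sigma (f x) >].

Lemma ker_predP x : reflect (f x = sigma (f x)) (ker_pred x).
Proof. exact: asboolP. Qed.

Fact ker_addr_closed : GRing.nmod_closed ker_pred.
Proof.
split=> [|x y /ker_predP fx /ker_predP fy]; apply/ker_predP.
  by rewrite !raddf0.
by rewrite !raddfD -fx -fy.
Qed.

Record ker_type := KerElt {ker_val :> L; ker_valP : ker_pred ker_val}.
HB.instance Definition _ := [isSub for ker_val].
HB.instance Definition _ := [Choice of ker_type by <:].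
HB.instance Definition _ :=
  GRing.SubChoice_isSubNmodule.Build L ker_pred ker_type ker_addr_closed.

Lemma ker_sigma_subproof (x : ker_type) : ker_pred (sigma (ker_val x)).
Proof. by apply/ker_predP; rewrite bmods_homP; congr (sigma _); apply/ker_predP/ker_valP. Qed.

Definition ker_sigma (x : ker_type) : ker_type := KerElt (ker_sigma_subproof x).

Fact ker_sigma_nmod_morphism : GRing.nmod_morphism ker_sigma.
Proof.
by split=> [|x y]; apply: val_inj; rewrite /= ?raddf0 ?raddfD.
Qed.
HB.instance Definition _ :=
  GRing.isNmodMorphism.Build ker_type ker_type ker_sigma ker_sigma_nmod_morphism.

Fact ker_addbb (x : ker_type) : x + x = x.
Proof. by apply: val_inj; rewrite raddfD /= addbb. Qed.

Fact ker_sigmaK : involutive ker_sigma.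
Proof. by move=> x; apply: val_inj; rewrite /= sigmaK. Qed.

Definition ker_bmods : bmods := @BmodsOf ker_type ker_addbb ker_sigma ker_sigmaK.

Definition ker_hom : bmods_hom ker_bmods L :=
  @BmodsHom ker_bmods L (val : {additive ker_type -> L}) (fun=> erefl).

End KernelObject.

(** * The congruence generated by [x ~ sigma x], as joinability *)

Section Congruence.
Variable M : bmods.
Implicit Types (E : M -> Prop) (a b c d x : M).

(* The premise [c + x = c] encodes [x <= c] in the semilattice [M]. *)
Inductive reach E a : M -> Prop :=
| reach_refl : reach E a a
| reach_step c x : reach E a c -> E x -> c + x = c -> reach E a (c + sigma x).

Definition cong E a b : Prop := exists2 c, reach E a c & reach E b c.

Lemma reach_trans E a b c : reach E a b -> reach E b c -> reach E a c.
Proof. by move=> ab; elim=> // d x _ ad Ex dx; apply: reach_step. Qed.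

Lemma reach_ge E a c : reach E a c -> c + a = c.
Proof.
elim=> [|d x _ da _ _]; first exact: addbb.
by rewrite addrAC da.
Qed.

Lemma reach_add E a c b : reach E a c -> reach E (a + b) (c + b).
Proof.
elim=> [|d x _ ad Ex dx]; first exact: reach_refl.
by rewrite addrAC; apply: reach_step => //; rewrite addrAC dx.
Qed.

(** Rewriting is increasing, so [c] absorbs [a]: adding [c] to each term of the path from [a] to [d]
    gives a path starting at [a + c = c]. By symmetry [c + d] is a common reduct of [c] and [d]. *)
Lemma reach_confl E a c d : reach E a c -> reach E a d -> reach E c (c + d).
Proof.
move=> /reach_ge ca ad.
by have := reach_add c ad; rewrite addrC ca addrC.
Qed.

Lemma reach_sigma E a c : (forall x, E x -> E (sigma x)) ->
  reach E a c -> reach E (sigma a) (sigma c).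
Proof.
move=> Es; elim=> [|d x _ ad Ex dx]; first exact: reach_refl.
by rewrite raddfD; apply: reach_step; [| exact: Es | rewrite -raddfD dx].
Qed.

(** A step adds [sigma x] with [x] below [d]; as [g (sigma x) = g x], this term is already absorbed
    by [g d]. *)
Lemma reach_hom E (X : bmods) (g : bmods_hom M X) a c :
  (forall x, E x -> g x = sigma (g x)) -> reach E a c -> g a = g c.
Proof.
move=> gE; elim=> // d x _ -> /gE gx dx.
by rewrite raddfD bmods_homP -gx -raddfD dx.
Qed.

Lemma reach_sub E E' a c : (forall x, E x -> E' x) ->
  reach E a c -> reach E' a c.
Proof.
move=> EE'; elim=> [|d x _ ad Ex dx]; first exact: reach_refl.
by apply: reach_step => //; apply: EE'.
Qed.

Lemma cong_refl E a : cong E a a.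
Proof. by exists a; apply: reach_refl. Qed.

Lemma cong_sym E a b : cong E a b -> cong E b a.
Proof. by case=> c ac bc; exists c. Qed.

Lemma cong_trans E b a c : cong E a b -> cong E b c -> cong E a c.
Proof.
move=> [d ad bd] [e be ce]; exists (d + e).
  exact/(reach_trans ad)/(reach_confl bd).
by apply: (reach_trans ce); rewrite addrC; apply: reach_confl be _.
Qed.

Lemma cong_add E a b c d : cong E a b -> cong E c d -> cong E (a + c) (b + d).
Proof.
move=> [e ae be] [f cf df]; apply: (cong_trans (b := b + c)).
  by exists (e + c); apply: reach_add.
by exists (f + b); rewrite addrC; apply: reach_add.
Qed.

Lemma cong_sigma E a b : (forall x, E x -> E (sigma x)) ->
  cong E a b -> cong E (sigma a) (sigma b).
Proof. by move=> Es [c ac bc]; exists (sigma c); apply: reach_sigma. Qed.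

Lemma cong_gen E x : (forall x, E x -> E (sigma x)) -> E x -> cong E x (sigma x).
Proof.
move=> Es Ex; exists (x + sigma x).
  by apply: reach_step; [exact: reach_refl | | exact: addbb].
(* Reading [x] as [sigma (sigma x)] turns the same sum into a single step from [sigma x]. *)
rewrite addrC -[X in _ + X]sigmaK.
by apply: reach_step; [exact: reach_refl | exact: Es | exact: addbb].
Qed.

Lemma cong_hom E (X : bmods) (g : bmods_hom M X) a b :
  (forall x, E x -> g x = sigma (g x)) -> cong E a b -> g a = g b.
Proof. by move=> gE [c ac bc]; rewrite (reach_hom gE ac) (reach_hom gE bc). Qed.

Lemma cong_sub E E' a b : (forall x, E x -> E' x) -> cong E a b -> cong E' a b.
Proof. by move=> EE' [c ac bc]; exists c; apply: reach_sub EE' _. Qed.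

End Congruence.

(** A step out of [m c] adds [sigma (m x)] with [m x] below [m c]. Injectivity reflects this
    inequality to [x] below [c], so the step is the image of one in [M], and the path stays in the
    image of [m]. *)
Lemma reach_inj (M P : bmods) (m : bmods_hom M P) (E : M -> Prop) a c' :
    injective m -> reach (fun y => exists2 x, E x & m x = y) (m a) c' ->
  exists2 c, m c = c' & reach E a c.
Proof.
move=> m_inj; elim=> [|_ _ _ [c <- ac] [x Ex <-] cx].
  by exists a => //; apply: reach_refl.
exists (c + sigma x); first by rewrite raddfD bmods_homP.
by apply: reach_step => //; apply: m_inj; rewrite raddfD.
Qed.

Lemma cong_inj (M P : bmods) (m : bmods_hom M P) (E : M -> Prop) a b :
    injective m -> cong (fun y => exists2 x, E x & m x = y) (m a) (m b) ->
  cong E a b.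
Proof.
move=> m_inj [_ /(reach_inj m_inj)[c <- ac] /(reach_inj m_inj)[d dc bd]].
by exists c => //; rewrite -(m_inj _ _ dc).
Qed.

(** * The quotient module by the congruence generated from the image *)

Section CokernelObject.
Variables (L M : bmods) (f : bmods_hom L M).

Definition im_pred (y : M) : Prop := exists x, f x = y.

Lemma im_sigma y : im_pred y -> im_pred (sigma y).
Proof. by move=> [x <-]; exists (sigma x); rewrite bmods_homP. Qed.

Definition cok_rel (a b : M) : bool := `[< cong im_pred a b >].

Fact cok_rel_equiv : equiv_class_of cok_rel.
Proof.
split=> [a|a b|b a c]; first exact/asboolP/cong_refl.
  by apply/asboolP/asboolP; apply: cong_sym.
by move=> /asboolP ab /asboolP bc; apply/asboolP/(cong_trans ab).
Qed.

Canonical cok_equiv : equiv_rel M := EquivRelPack cok_rel_equiv.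

Definition cok_type := {eq_quot cok_equiv}.
HB.instance Definition _ := Choice.on cok_type.
HB.instance Definition _ := EqQuotient.on cok_type.

Definition cok_pi (a : M) : cok_type := \pi_cok_type a.

Lemma cok_piP (a b : M) : cok_pi a = cok_pi b <-> cong im_pred a b.
Proof.
by split=> [/eqmodP/asboolP | ab]; last exact/eqmodP/asboolP.
Qed.

Lemma cok_piK (x : cok_type) : cok_pi (repr x) = x.
Proof. exact: reprK. Qed.

Definition cok_add (x y : cok_type) : cok_type := cok_pi (repr x + repr y).
Definition cok_sigma (x : cok_type) : cok_type := cok_pi (sigma (repr x)).

Lemma cok_piD a b : cok_pi (a + b) = cok_add (cok_pi a) (cok_pi b).
Proof. by apply/cok_piP; apply: cong_add; apply/cok_piP; rewrite cok_piK. Qed.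

Lemma cok_pi_sigma a : cok_pi (sigma a) = cok_sigma (cok_pi a).
Proof.
by apply/cok_piP; apply: (cong_sigma im_sigma); apply/cok_piP; rewrite cok_piK.
Qed.

Fact cok_addA : associative cok_add.
Proof.
move=> x y z; rewrite -(cok_piK x) -(cok_piK y) -(cok_piK z).
by rewrite -!cok_piD addrA.
Qed.

Fact cok_addC : commutative cok_add.
Proof. by move=> x y; rewrite /cok_add addrC. Qed.

Fact cok_add0 : left_id (cok_pi 0) cok_add.
Proof. by move=> x; rewrite -(cok_piK x) -cok_piD add0r. Qed.

HB.instance Definition _ :=
  GRing.isNmodule.Build cok_type cok_addA cok_addC cok_add0.

Fact cok_sigma_nmod_morphism : GRing.nmod_morphism cok_sigma.
Proof.
split=> [|x y]; first by rewrite -[0]/(cok_pi 0) -cok_pi_sigma raddf0.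
rewrite -(cok_piK x) -(cok_piK y) -[_ + _]cok_piD -!cok_pi_sigma raddfD.
exact: cok_piD.
Qed.
HB.instance Definition _ :=
  GRing.isNmodMorphism.Build cok_type cok_type cok_sigma cok_sigma_nmod_morphism.

Fact cok_pi_nmod_morphism : GRing.nmod_morphism cok_pi.
Proof. by split=> // x y; apply: cok_piD. Qed.
HB.instance Definition _ :=
  GRing.isNmodMorphism.Build M cok_type cok_pi cok_pi_nmod_morphism.

Fact cok_addbb (x : cok_type) : x + x = x.
Proof. by rewrite -(cok_piK x) -raddfD addbb. Qed.

Fact cok_sigmaK : involutive cok_sigma.
Proof. by move=> x; rewrite -(cok_piK x) -!cok_pi_sigma sigmaK. Qed.

Definition cok_bmods : bmods := @BmodsOf cok_type cok_addbb cok_sigma cok_sigmaK.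

Definition cok_hom : bmods_hom M cok_bmods :=
  @BmodsHom M cok_bmods cok_pi cok_pi_sigma.

End CokernelObject.

(** * Elementwise description of arbitrary kernels and cokernels *)

Section KernelCokernel.
Variables (L M : bmods) (f : bmods_hom L M).
Local Notation is_ker := (@is_kernel Bmods bmods_null L M f).
Local Notation is_cok := (@is_cokernel Bmods bmods_null L M f).

Lemma bmods_is_kernel (K : bmods) (k : bmods_hom K L) :
    injective k -> (forall x, f x = sigma (f x) <-> exists y, k y = x) ->
  is_ker k.
Proof.
move=> k_inj kE; split=> [y|X g fg]; first by apply/kE; exists y.
have [|h hE] := bmods_factor_inj (g := g) k_inj.
  by move=> x; apply/kE/fg.
exists h; split=> // h' h'E; apply: bmods_hom_eq => x; apply: k_inj.
by move: h'E; rewrite hE => /(bmods_hom_congr x).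
Qed.

Lemma bmods_ker_hom : is_ker (ker_hom f).
Proof.
apply: bmods_is_kernel => [x y xy|x]; first exact: val_inj.
by split=> [/ker_predP xP|[y <-]]; [exists (KerElt xP) | exact/ker_predP/ker_valP].
Qed.

(** Any kernel is isomorphic over [L] to the concrete [ker_hom f], from which it inherits
    injectivity and its image. *)
Lemma bmods_kernelP (K : bmods) (k : bmods_hom K L) :
  is_ker k <->
  injective k /\ forall x, f x = sigma (f x) <-> exists y, k y = x.
Proof.
split=> [kerk|[]]; last exact: bmods_is_kernel.
have [u [uE _]] := proj2 kerk _ _ (proj1 bmods_ker_hom).
have [v [vE _]] := proj2 bmods_ker_hom _ _ (proj1 kerk).
have uvK : u \oc v = idc (K : Bmods).
  by apply: (kernel_inj bmods_null_ideal kerk); rewrite compcA -uE -vE compc1.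
have vK y : u (v y) = y := bmods_hom_congr y uvK.
split=> [x y kxy|x].
  rewrite -(vK x) -(vK y); congr (bmods_fun u _); apply: val_inj.
  by move: kxy; rewrite vE.
split=> [/ker_predP xP|[y <-]]; last exact: (proj1 kerk).
by exists (bmods_fun u (KerElt xP)); rewrite -bmods_comp_apply -uE.
Qed.

Lemma bmods_cok_hom : is_cok (cok_hom f).
Proof.
split=> [x|X g gf].
  rewrite bmods_comp_apply -bmods_homP; apply/cok_piP/cong_gen.
    exact: im_sigma.
  by exists x.
have surj y : exists x, cok_hom f x = y by exists (repr y); apply: cok_piK.
have [|h hE] := bmods_factor_surj (g := g) surj.
  by move=> a b /cok_piP; apply: cong_hom => _ [x <-]; apply: gf.
exists h; split=> // h' h'E; apply: bmods_hom_eq => y; have [x <-] := surj y.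
by move: h'E; rewrite hE => /(bmods_hom_congr x).
Qed.

Lemma bmods_cokernel_surj (Q : bmods) (c : bmods_hom M Q) :
  is_cok c -> forall y, exists x, c x = y.
Proof.
move=> cokc; have [u [uE _]] := proj2 cokc _ _ (proj1 bmods_cok_hom).
have [v [vE _]] := proj2 bmods_cok_hom _ _ (proj1 cokc).
have vuK : v \oc u = idc (Q : Bmods).
  by apply: (cokernel_inj bmods_null_ideal cokc); rewrite -compcA -uE -vE comp1c.
move=> y; exists (repr (u y)).
rewrite -[RHS](bmods_hom_congr y vuK) vE !bmods_comp_apply.
by congr (bmods_fun v _); apply: cok_piK.
Qed.

(** The quotient map [cok_hom f] factors through [c], so [c] identifies no more than the congruence
    does. *)
Lemma bmods_cokernel_cong (Q : bmods) (c : bmods_hom M Q) a b :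
  is_cok c -> c a = c b -> cong (im_pred f) a b.
Proof.
move=> cokc cab; have [u [uE _]] := proj2 cokc _ _ (proj1 bmods_cok_hom).
by apply/cok_piP; rewrite -[LHS]/(cok_hom f a) -[RHS]/(cok_hom f b) uE /= cab.
Qed.

End KernelCokernel.

(** * Semiexactness of the category *)

Lemma bmods_kernel_ex (L M : Bmods) (f : hom L M) :
  exists (K : Bmods) (k : hom K L), is_kernel bmods_null f k.
Proof. by exists (ker_bmods f), (ker_hom f); apply: bmods_ker_hom. Qed.

Lemma bmods_cokernel_ex (L M : Bmods) (f : hom L M) :
  exists (Q : Bmods) (c : hom M Q), is_cokernel bmods_null f c.
Proof. by exists (cok_bmods f), (cok_hom f); apply: bmods_cok_hom. Qed.

Lemma bmods_null_closed : closed_ideal bmods_null.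
Proof.
split=> [|A B f f0]; first exact: bmods_null_ideal.
(* The kernel of the identity is the submodule of fixed points of [sigma]: it is a null object, and
   every null morphism to [B] lands in it. *)
have [K [k kerk]] := bmods_kernel_ex (idc B).
have [|h [hE _]] := proj2 kerk _ f; first by rewrite comp1c.
have [k_inj kP] := proj1 (bmods_kernelP _ _) kerk.
exists K, h, k; split=> // x; apply: k_inj; rewrite bmods_homP.
by apply/kP; exists x.
Qed.

(** * Normal monomorphisms and epimorphisms, and their stability under composition (ex2) *)

(** If [q] is a cokernel of [f], then [f] factors through [k], so whatever makes [k] null makes [f]
    null and factors through [q]. *)
Lemma normal_epi_cokernel (C : category) (N : hom_class C) (P Q K : C)
    (q : hom P Q) (k : hom K P) :
  hom_ideal N -> normal_epi N q -> is_kernel N q k -> is_cokernel N k q.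
Proof.
move=> idN [R [f [qf qU]]] [qk kU]; split=> // X g gk; apply: qU.
have [h [-> _]] := kU _ f qf.
by rewrite compcA -(comp1c (g \oc k)); apply: idN.
Qed.

Lemma bmods_normal_mono_comp (A B D : Bmods) (m : hom A B) (n : hom B D) :
  normal_mono bmods_null m -> normal_mono bmods_null n ->
  normal_mono bmods_null (n \oc m).
Proof.
move=> [R [g /bmods_kernelP[m_inj mP]]] [S [f /bmods_kernelP[n_inj nP]]].
(* The composite is shown to be the kernel of its own cokernel. *)
have [Q [c cokc]] := bmods_cokernel_ex (n \oc m).
exists Q, c; apply/bmods_kernelP; split=> [|y]; first exact: inj_comp.
split=> [cy|[x <-]]; last exact: (proj1 cokc).
have: cong (im_pred (n \oc m)) y (sigma y).
  by apply: (bmods_cokernel_cong cokc); rewrite bmods_homP.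
(* [f] is null on the image of [n], hence constant on congruence classes: [f y = f (sigma y)], which
   puts [y] in the image of [n]. *)
have [b <-] : exists b, n b = y.
  apply/nP; rewrite -bmods_homP.
  apply: cong_hom (bmods_cokernel_cong cokc _); last by rewrite bmods_homP.
  by move=> _ [x <-]; apply/nP; exists (bmods_fun m x).
rewrite -bmods_homP => nb.
(* The congruence is pulled back along the injection [n]; the same argument with [g] then puts [b]
   in the image of [m]. *)
have {nb}: cong (im_pred m) b (sigma b).
  apply: (cong_inj n_inj); apply: cong_sub nb => _ [x <-].
  by exists (bmods_fun m x) => //; exists x.
have gm x : im_pred m x -> bmods_fun g x = sigma (bmods_fun g x) by move/mP.
move=> /(cong_hom gm); rewrite bmods_homP => /mP[x <-].
by exists x.
Qed.

Lemma bmods_normal_epi_comp (A B D : Bmods) (p : hom A B) (q : hom B D) :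
  normal_epi bmods_null p -> normal_epi bmods_null q ->
  normal_epi bmods_null (q \oc p).
Proof.
move=> [R [f cokp]] [S [g cokq]].
(* The composite is shown to be the cokernel of its own kernel. *)
have [K [k kerk]] := bmods_kernel_ex (q \oc p).
have [_ kP] := proj1 (bmods_kernelP _ _) kerk.
exists K, k; split=> [|X r rk]; first exact: (proj1 kerk).
have [|u [uE _]] := proj2 cokp _ r.
  have [|h [-> _]] := proj2 kerk _ f.
    rewrite -compcA -(compc1 (q \oc _)); apply: bmods_null_ideal.
    exact: (proj1 cokp).
  by rewrite compcA -(comp1c (r \oc k)); apply: bmods_null_ideal.
have [z|v [vE _]] := proj2 cokq _ u.
  rewrite bmods_comp_apply.
  (* A lift [a] of [g z] along [p] lies in the kernel of [q \oc p], where [r] takes fixed values;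
     and [r a = u (g z)]. *)
  have [a aE] := bmods_cokernel_surj cokp (bmods_fun g z).
  have /kP[e eE] : bmods_fun (q \oc p) a = sigma (bmods_fun (q \oc p) a).
    by rewrite bmods_comp_apply aE; apply: (proj1 cokq).
  by rewrite -aE -eE; have := rk e; rewrite uE.
exists v; split=> [|w wE]; first by rewrite compcA -vE.
apply: (cokernel_inj bmods_null_ideal cokq).
apply: (cokernel_inj bmods_null_ideal cokp).
by rewrite -!compcA -wE uE vE compcA.
Qed.

(** * Exactness of [q \oc m] (ex3): the comparison map [t] is bijective *)

Lemma bmods_ex3 : ex3 bmods_null.
Proof.
move=> M P Q m q K k [R [r kerm]] epiq kerk [h hE].
have [m_inj mP] := proj1 (bmods_kernelP _ _) kerm.
have cokq := normal_epi_cokernel bmods_null_ideal epiq kerk.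
have [K' [k' kerk']] := bmods_kernel_ex (q \oc m).
have [Q' [c cokc]] := bmods_cokernel_ex k'.
have [P' [p cokp]] := bmods_cokernel_ex (q \oc m).
have [I [i keri]] := bmods_kernel_ex p.
have [t [tP _]] := normal_factorization_ex bmods_null_closed kerk' cokc cokp keri.
exists K', k', Q', c, P', p, I, i, t; split=> //; case: tP => _ _ _ _ fE.
have [i_inj iP] := proj1 (bmods_kernelP _ _) keri.
have qmE a : bmods_fun q (bmods_fun m a) = i (t (c a)).
  by rewrite -bmods_comp_apply fE.
apply: bmods_bij_iso => [x y|y].
  have [a <-] := bmods_cokernel_surj cokc x.
  have [b <-] := bmods_cokernel_surj cokc y.
  move=> tab; have qab : bmods_fun q (bmods_fun m a) = bmods_fun q (bmods_fun m b).
    by rewrite !qmE tab.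
  (* As [k = m \oc h], the image of [k] is carried by [m], so the congruence defining [q] pulls back
     to [M]. It is collapsed by [c] because [h] factors through the kernel of [q \oc m]. *)
  have {qab} hab : cong (im_pred h) a b.
    apply: (cong_inj m_inj); apply: cong_sub (bmods_cokernel_cong cokq qab).
    by move=> _ [x' <-]; exists (bmods_fun h x'); [exists x' | rewrite hE].
  apply: cong_hom hab => _ [x' <-].
  have [|h' [-> _]] := proj2 kerk' _ h.
    by rewrite -compcA -hE; apply: (proj1 kerk).
  by rewrite bmods_comp_apply; apply: (proj1 cokc).
(* For surjectivity, a lift [n] of [i y] along [q] must lie in the image of [m], that is, [r n] must
   be fixed. The map [r] factors through [q], then through [p], and [p] takes a fixed value at
   [i y]. *)
have [n nE] := bmods_cokernel_surj cokq (bmods_fun i y).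
have [|g [gE _]] := proj2 cokq _ r.
  by rewrite hE compcA -(comp1c (r \oc m)); apply/bmods_null_ideal/(proj1 kerm).
have [|u [uE _]] := proj2 cokp _ g.
  by rewrite compcA -gE; apply: (proj1 kerm).
have /mP[a aE] : bmods_fun r n = sigma (bmods_fun r n).
  rewrite gE uE !bmods_comp_apply nE -bmods_homP.
  by congr (bmods_fun u _); apply/iP; exists y.
by exists (c a); apply: i_inj; rewrite -qmE aE.
Qed.

Theorem theorem1p3 : homological bmods_null.
Proof.
split; last exact: bmods_ex3.
  split; [exact: bmods_null_closed | exact: bmods_kernel_ex |].
  exact: bmods_cokernel_ex.
split; [exact: bmods_normal_mono_comp | exact: bmods_normal_epi_comp].
Qed.
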